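(* For $x=(x_0,\ldots,x_{n-1})\in\mathbb{B}^n$, let $\mathrm{S}(x)=\{i\in X_n: x_i=1\}$ be the support of $x$. Then $x\mathbf{P}_n=x$ (matrix multiplication over the Boolean algebra $\mathbb{B}$) if and only if $\mathrm{S}(x)$ is an order ideal of the Pascal poset $\mathbb{P}_n$. Moreover, $$D_P(n)=\bigl|\{x\in\mathbb{B}^n : x\mathbf{P}_n=x\}\bigr|.$$
   Context: $X_n=\{0,1,\ldots,n-1\}$, and $\mathbb{B}=\{0,1\}$ is the Boolean algebra with $a+b=\max\{a,b\}$ and $a\cdot b=\min\{a,b\}$. The binary Pascal matrix $\mathbf{P}_n$ is the $n\times n$ $(0,1)$-matrix with $(\mathbf{P}_n)_{i,j}\equiv\binom{i}{j}\pmod2$, $0\le i,j\le n-1$, regarded as a matrix over $\mathbb{B}$; $x\in\mathbb{B}^n$ is a row vector. The Pascal poset $\mathbb{P}_n$ is the poset on $X_n$ with $j\preceq i$ iff $(\mathbf{P}_n)_{i,j}=1$. An order ideal of a poset is a subset $J$ such that $x\in J$ and $y\preceq x$ imply $y\in J$. The Dedekind-Pascal number $D_P(n)$ is the number of antichains of $\mathbb{P}_n$ (including the empty antichain). *)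

(* Defs.v *)
From HB Require Import structures.
From mathcomp Require Import all_boot all_order all_algebra.

Set Implicit Arguments.
Unset Strict Implicit.
Unset Printing Implicit Defensive.

Import Order.TTheory GRing.Theory.
Local Open Scope ring_scope.

(* The library's ring structure on [bool] is the field F_2 (addition is xor),
   hence the alias: here addition is max = [||] and 1 + 1 = 1. *)
Definition boolalg : Type := bool.

HB.instance Definition _ := Finite.on boolalg.
HB.instance Definition _ := GRing.isNzSemiRing.Build boolalg
  orbA orbC orFb andbA andTb andbT andb_orl andb_orr andFb andbF isT.
HB.instance Definition _ :=
  GRing.PzSemiRing_hasCommutativeMul.Build boolalg andbC.

Definition pascal_mx (n : nat) : 'M[boolalg]_n :=
  \matrix_(i < n, j < n) (odd 'C(i, j) : boolalg).

Section OrderNotions.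
Context {d : Order.disp_t} {T : finPOrderType d}.

Definition order_ideal (J : {set T}) : Prop :=
  forall x y : T, x \in J -> (y <= x)%O -> y \in J.

Definition antichain (A : {set T}) : bool :=
  [forall x in A, forall y in A, (x != y) ==> (x >< y)%O].

End OrderNotions.

(* A separate carrier, so as not to clash with the usual order on ['I_n]. *)
Definition pascal_poset (n : nat) : Type := 'I_n.

Fact pascal_display : Order.disp_t.
Proof. exact: Order.Disp tt tt. Qed.

Section PascalPoset.
Variable n : nat.

HB.instance Definition _ := Finite.on (pascal_poset n).

Definition pascal_le (j i : pascal_poset n) : bool := pascal_mx n i j == 1.

Lemma pascal_leE (j i : 'I_n) : pascal_le j i = odd 'C(i, j).
Proof. by rewrite /pascal_le mxE; case: odd. Qed.

Lemma pascal_le_refl : reflexive pascal_le.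
Proof. by move=> i; rewrite pascal_leE binn. Qed.

Lemma pascal_le_leq (j i : 'I_n) : pascal_le j i -> (j <= i)%N.
Proof. by rewrite pascal_leE; case: leqP => // /bin_small ->. Qed.

Lemma pascal_le_anti : antisymmetric pascal_le.
Proof.
move=> i j /andP[/pascal_le_leq ij /pascal_le_leq ji].
by apply/val_inj/eqP; rewrite eqn_leq ij ji.
Qed.

Lemma bin_mul_bin (m k l : nat) : (l <= k <= m)%N ->
  ('C(m, k) * 'C(k, l) = 'C(m, l) * 'C(m - l, k - l))%N.
Proof.
move=> /andP[lk km]; have lm := leq_trans lk km.
have kl_ml : (k - l <= m - l)%N by rewrite leq_sub2r.
apply/eqP; rewrite -(eqn_pmul2r (fact_gt0 l)) -(eqn_pmul2r (fact_gt0 (k - l))).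
rewrite -(eqn_pmul2r (fact_gt0 (m - k))).
have -> : ('C(m, k) * 'C(k, l) * l`! * (k - l)`! * (m - k)`! = m`!)%N.
  by rewrite -!mulnA (mulnA l`!) mulnA -(bin_fact km) -(bin_fact lk) !mulnA.
have -> : ('C(m, l) * 'C(m - l, k - l) * l`! * (k - l)`! * (m - k)`! = m`!)%N.
  rewrite -(bin_fact lm) -(bin_fact kl_ml) subnBA // subnK // !mulnA.
  by rewrite [X in (X * _ * _)%N]mulnAC.
exact: eqxx.
Qed.

Lemma pascal_le_trans : transitive pascal_le.
Proof.
move=> i j k ji ik.
have lji := pascal_le_leq ji; have lik := pascal_le_leq ik.
move: ji ik; rewrite !pascal_leE => Oij Oki.
have : odd ('C(k, i) * 'C(i, j)) by rewrite oddM Oki.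
by rewrite bin_mul_bin ?lji // oddM => /andP[].
Qed.

HB.instance Definition _ := Order.Le_isPOrder.Build pascal_display
  (pascal_poset n) pascal_le_refl pascal_le_anti pascal_le_trans.

End PascalPoset.

Definition vec_support (n : nat) (x : 'rV[boolalg]_n) : {set pascal_poset n} :=
  [set i : pascal_poset n | x 0 i == 1].

Definition dedekind_pascal (n : nat) : nat :=
  #|[set A : {set pascal_poset n} | antichain A]|.

(* Main.v *)
(** Row [j] of [x P_n] is the disjunction of the [x_i] over [j <= i] in the
    Pascal poset, so multiplying by [P_n] replaces the support of [x] by the
    down-set it generates; the fixed vectors are those with down-closed support.
    In a finite poset every order ideal is generated by its maximal elements, and
    an antichain is the set of maximal elements of its down-set, so antichains
    and order ideals are in bijection. *)
Require Import Defs.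
From HB Require Import structures.
From mathcomp Require Import all_boot all_order all_algebra.

Set Implicit Arguments.
Unset Strict Implicit.
Unset Printing Implicit Defensive.

Import Order.TTheory.

Local Open Scope ring_scope.

Section DownSets.
Context {d : Order.disp_t} {T : finPOrderType d}.
Implicit Types (A J : {set T}) (x y : T).

Definition downset A : {set T} := [set y | [exists x in A, (y <= x)%O]].

Definition maximals J : {set T} := [set x in J | [forall y in J, ~~ (x < y)%O]].

Lemma downsetP A y :
  reflect (exists2 x, x \in A & (y <= x)%O) (y \in downset A).
Proof. by rewrite inE; apply: exists_inP. Qed.

Lemma maximalsP J x :
  reflect (x \in J /\ forall y, y \in J -> ~~ (x < y)%O) (x \in maximals J).
Proof.
rewrite inE; apply: (iffP andP) => -[xJ xmax]; split=> //.
  exact/forall_inP.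
exact/forall_inP.
Qed.

(** A single inequality suffices: [x] and [y] range symmetrically over [A], so both cases of
    comparability are covered. *)
Lemma antichainP A :
  reflect {in A &, forall x y, (x <= y)%O -> x = y} (antichain A).
Proof.
apply: (iffP forall_inP) => [antiA x y xA yA le_xy | antiA x xA].
  apply/eqP/negPn/negP => neq_xy.
  have /forall_inP/(_ y yA) := antiA x xA.
  by rewrite neq_xy /= /Order.comparable le_xy.
apply/forall_inP=> y yA; apply/implyP; apply: contraNN => /orP[] le_xy.
  by apply/eqP/antiA.
by rewrite eq_sym; apply/eqP/antiA.
Qed.

Lemma downset_ideal A : order_ideal (downset A).
Proof.
move=> x y /downsetP[z zA le_xz] le_yx.
by apply/downsetP; exists z => //; apply: le_trans le_xz.
Qed.

Lemma downset_id J : downset J = J <-> order_ideal J.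
Proof.
split=> [<- | idJ]; first exact: downset_ideal.
apply/setP=> y; apply/downsetP/idP => [[x xJ] | yJ]; first exact: idJ.
by exists y.
Qed.

Lemma maximals_antichain J : antichain (maximals J).
Proof.
apply/antichainP=> x y /maximalsP[_ xmax] /maximalsP[yJ _].
by rewrite le_eqVlt (negPf (xmax y yJ)) orbF => /eqP.
Qed.

Lemma maximal_above J x :
  x \in J -> exists2 y, y \in maximals J & (x <= y)%O.
Proof.
move=> xJ; pose P := [pred y in J | (x <= y)%O].
have Px : P x by rewrite /= xJ lexx.
(* Among the elements of [J] above [x], take one whose principal down-set is largest: the size of
   principal down-sets is strictly increasing along the order, so nothing in [J] lies strictly above
   it. *)
case: (@arg_maxnP _ x P (fun y => #|downset [set y]|) Px) => y.
move=> /andP[yJ le_xy] ymax; exists y => //.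
apply/maximalsP; split=> // z zJ; apply/negP => lt_yz.
have Pz : P z by rewrite /= zJ (le_trans le_xy (ltW lt_yz)).
suff : (#|downset [set y]| < #|downset [set z]|)%N by rewrite ltnNge => /negP[]; apply: ymax.
apply/proper_card/properP; split.
  apply/subsetP=> w /downsetP[_ /set1P-> le_wy].
  by apply/downsetP; exists z; rewrite ?set11 // (le_trans le_wy (ltW lt_yz)).
exists z; first by apply/downsetP; exists z; rewrite ?set11.
by apply/downsetP=> -[_ /set1P-> /le_gtF]; rewrite lt_yz.
Qed.

Lemma downset_maximals J : order_ideal J -> downset (maximals J) = J.
Proof.
move=> idJ; apply/setP=> y; apply/downsetP/idP => [[x]|].
  by move=> /maximalsP[xJ _]; apply: idJ.
exact: maximal_above.
Qed.

(** A maximal element of the down-set lies below some element of [A], hence equals it. Conversely,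
    an element of [A] strictly below a member of the down-set would be strictly below an element of
    [A]. *)
Lemma maximals_downset A : antichain A -> maximals (downset A) = A.
Proof.
move=> /antichainP antiA; apply/setP=> x; apply/maximalsP/idP.
  move=> [/downsetP[y yA le_xy] xmax].
  have yD : y \in downset A by apply/downsetP; exists y.
  by move: le_xy; rewrite le_eqVlt (negPf (xmax y yD)) orbF => /eqP->.
move=> xA; split=> [|y /downsetP[z zA le_yz]]; first by apply/downsetP; exists x.
apply/negP=> lt_xy; have lt_xz := lt_le_trans lt_xy le_yz.
by have := lt_xz; rewrite (antiA _ _ xA zA (ltW lt_xz)) ltxx.
Qed.

(** Ideals appear as fixed points of [downset] because [order_ideal] is a [Prop], whereas a set
    comprehension needs a boolean. On antichains [downset] has left inverse [maximals], and its
    image is exactly these fixed points. *)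
Lemma card_antichains :
  #|[set A : {set T} | antichain A]| = #|[set J : {set T} | downset J == J]|.
Proof.
have inj : {in [set A : {set T} | antichain A] &, injective downset}.
  move=> A B; rewrite !inE => /maximals_downset {2}<- /maximals_downset {2}<-.
  by move->.
rewrite -(card_in_imset inj); apply: eq_card => J; rewrite inE.
apply/imsetP/eqP => [[A _ ->] | /downset_id idJ].
  exact/downset_id/downset_ideal.
by exists (maximals J); rewrite ?inE ?maximals_antichain ?downset_maximals.
Qed.

End DownSets.

Section PascalFixedVectors.
Variable n : nat.
Implicit Type x : 'rV[boolalg]_n.

Lemma vec_support_bij : bijective (@vec_support n).
Proof.
exists (fun J : {set pascal_poset n} =>
    \row_i ((i : pascal_poset n) \in J : boolalg)).
  by move=> x; apply/rowP=> i; rewrite mxE inE; case: (x 0 i).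
by move=> J; apply/setP=> i; rewrite inE mxE; case: (i \in J).
Qed.

Lemma boolalg_sum_eq1 (I : finType) (F : I -> boolalg) :
  (\sum_i F i == 1) = [exists i, F i == 1].
Proof.
(* Addition in [boolalg] is [orb] by conversion, so the sum can be read as an iterated
   disjunction. *)
transitivity (\sum_i F i : bool); first by case: (\sum_i F i).
rewrite [LHS](big_orE xpredT F); apply: eq_existsb => i.
by case: (F i).
Qed.

Lemma vec_support_mul_pascal x :
  vec_support (x *m pascal_mx n) = downset (vec_support x).
Proof.
apply/setP=> j; rewrite !inE mxE boolalg_sum_eq1; apply: eq_existsb => i.
(* The order of the Pascal poset unfolds to a matrix entry, so both sides are conditions on [x 0 i]
   and [pascal_mx n i j]. *)
rewrite inE [(j <= i)%O]/(pascal_mx n i j == 1).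
by case: (x 0 i); case: (pascal_mx n i j).
Qed.

Lemma pascal_fixedE x :
  (x *m pascal_mx n == x) = (downset (vec_support x) == vec_support x).
Proof.
by rewrite -vec_support_mul_pascal (inj_eq (bij_inj vec_support_bij)).
Qed.

End PascalFixedVectors.

Theorem theorem6p4 (n : nat) :
  (forall x : 'rV[boolalg]_n,
     x *m pascal_mx n = x <-> order_ideal (vec_support x)) /\
  dedekind_pascal n = #|[set x : 'rV[boolalg]_n | x *m pascal_mx n == x]|.
Proof.
split=> [x|].
  split=> [/eqP|/downset_id/eqP]; rewrite -?pascal_fixedE; last exact/eqP.
  by rewrite pascal_fixedE => /eqP/downset_id.
rewrite /dedekind_pascal card_antichains.
(* Ideals are counted through their preimage under the support bijection. *)
rewrite -(on_card_preimset (onW_bij _ (@vec_support_bij n))).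
by apply: eq_card => x; rewrite !inE pascal_fixedE.
Qed.
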